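(* Let $\alpha$ be a constant with $0.717\leq\alpha\leq 1$ and let $\beta>(2\alpha-1)/4$. Then there exists $n_0$ such that the following holds for every graph $G$ on $n\geq n_0$ vertices: if for every subset $A\subseteq V(G)$ with $|A|=\lfloor\alpha n\rfloor$ we have $e(A)+e(A^c)\geq \beta n^2$, then $G$ contains a triangle.
   Context: For $A\subseteq V(G)$, $e(A)$ denotes the number of edges of $G$ with both endpoints in $A$, and $A^c=V(G)\setminus A$. *)

(* Defs.v *)
From HB Require Import structures.
From mathcomp Require Import all_boot all_order all_algebra.
From mathcomp Require Import reals.

Set Implicit Arguments.
Unset Strict Implicit.
Unset Printing Implicit Defensive.

(* A finite simple graph is a finType of vertices with a
   symmetric irreflexive adjacency relation; an edge is the unordered pair
   [set x; y] of its endpoints, so each edge is counted once. *)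

Definition edge_set (V : finType) (adj : rel V) : {set {set V}} :=
  [set [set x; y] | x in V, y in V & adj x y].

Definition edges_inside (V : finType) (adj : rel V) (A : {set V}) : nat :=
  #|[set E in edge_set adj | E \subset A]|.

Definition has_triangle (V : finType) (adj : rel V) : Prop :=
  exists x y z : V, [/\ adj x y, adj y z & adj x z].

(* Main.v *)
Require Import Defs.
From HB Require Import structures.
From mathcomp Require Import all_boot all_order all_algebra.
From mathcomp Require Import boolp reals.
From mathcomp Require Import ring lra.

Set Implicit Arguments.
Unset Strict Implicit.
Unset Printing Implicit Defensive.

Import Order.TTheory GRing.Theory Num.Theory.
Local Open Scope ring_scope.

(* Write n = |V|, k = n - |A|, d(v) for the degrees and S(v) for the sum of the
   degrees of the neighbours of v.  Partitions (A, A^c) may be replaced by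
   fractional ones: the number of uncut edges is concave when mass moves between
   two vertices, so a fractional A^c of weight k rounds to a set of size k at no
   cost.  For each v we test the fractional A^c spread uniformly over N(v) if
   d(v) >= k, and otherwise equal to 1 on N(v) and constant elsewhere; as N(v) is
   independent the cost depends only on e(G), d(v) and S(v).  If all these costs
   exceed (n^2 - 2kn)/4 then S(v) < d(v)^2 - q (d(v) - q) for every v, where q is
   the average degree.  Summing over v contradicts sum S(v) = sum d(v)^2. *)

(** * Quadratic cost of a fractional vertex set *)

Section Cost.
Variables (R : realFieldType) (V : finType) (adj : rel V).

Definition weight (i j : V) : R := (adj i j)%:R.

Definition degree (i : V) : R := \sum_j weight i j.

Definition volume : R := \sum_i degree i.

Definition nbr_degrees (v : V) : R := \sum_i weight v i * degree i.

(* [y] is a fractional vertex set; at the indicator of [B] the cost is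
   [2 (e(B) + e(~: B))], every edge being counted in both directions. *)
Definition cost (y : V -> R) : R :=
  \sum_i \sum_j weight i j * (y i * y j + (1 - y i) * (1 - y j)).

(** The derivative of [cost] at [y] in the direction [z]. *)
Definition cost_slope (y z : V -> R) : R :=
  \sum_i \sum_j weight i j * (2 * (y i * z j + z i * y j) - z i - z j).

Definition pair_energy (z : V -> R) : R :=
  \sum_i \sum_j weight i j * (z i * z j).

Lemma costD (y z : V -> R) (t : R) :
  cost (fun i => y i + t * z i)
  = cost y + t * cost_slope y z + 2 * t ^+ 2 * pair_energy z.
Proof.
rewrite /cost /cost_slope /pair_energy !mulr_sumr -!big_split /=.
apply: eq_bigr => i _; rewrite !mulr_sumr -!big_split /=.
by apply: eq_bigr => j _; ring.
Qed.

Lemma cost_slopeN (y z : V -> R) :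
  cost_slope y (fun i => - z i) = - cost_slope y z.
Proof.
rewrite /cost_slope -sumrN; apply: eq_bigr => i _.
by rewrite -sumrN; apply: eq_bigr => j _; ring.
Qed.

Lemma eq_cost (y z : V -> R) : y =1 z -> cost y = cost z.
Proof.
by move=> yz; apply: eq_bigr => i _; apply: eq_bigr => j _; rewrite !yz.
Qed.

(** * Transfers of mass and rounding to a set *)

Definition transfer (i j l : V) : R := (l == i)%:R - (l == j)%:R.

Lemma sum_transfer (i j : V) (f : V -> R) :
  \sum_l f l * transfer i j l = f i - f j.
Proof.
have pick k : \sum_l f l * (l == k)%:R = f k.
  rewrite (bigD1 k) //= eqxx mulr1 big1 ?addr0 // => l /negbTE ->.
  by rewrite mulr0.
by rewrite -!pick -sumrB; apply: eq_bigr => l _; rewrite mulrBr.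
Qed.

Lemma transferC (i j : V) : transfer j i =1 (fun l => - transfer i j l).
Proof. by move=> l; rewrite /transfer opprB. Qed.

Hypothesis adj_sym : symmetric adj.
Hypothesis adj_irr : irreflexive adj.

Lemma weightC (i j : V) : weight i j = weight j i.
Proof. by rewrite /weight adj_sym. Qed.

(** Diagonal terms vanish by irreflexivity, leaving [- 2 * weight i j]. This is the concavity of
    [cost] along transfers. *)
Lemma pair_energy_transfer (i j : V) :
  pair_energy (transfer i j) <= 0.
Proof.
have -> : pair_energy (transfer i j) = - 2 * weight i j.
  have -> : pair_energy (transfer i j)
      = \sum_k (weight k i - weight k j) * transfer i j k.
    apply: eq_bigr => k _; rewrite -(sum_transfer i j (weight k)) mulr_suml.
    by apply: eq_bigr => l _; ring.
  by rewrite sum_transfer (weightC j i) /weight !adj_irr /=; ring.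
by rewrite mulNr oppr_le0 mulr_ge0.
Qed.

Definition fractional (y : V -> R) : {set V} := [set i | 0 < y i < 1].

Lemma cost_transfer (y : V -> R) (i j : V) :
  (forall l, 0 <= y l <= 1) -> i != j ->
  i \in fractional y -> j \in fractional y ->
  cost_slope y (transfer i j) <= 0 ->
  exists z : V -> R, [/\ forall l, 0 <= z l <= 1,
    \sum_l z l = \sum_l y l, cost z <= cost y
    & fractional z \proper fractional y].
Proof.
move=> y01 neq_ij fi fj slope.
have := fi; have := fj; rewrite !inE => /andP[yj0 yj1] /andP[yi0 yi1].
(* The largest step that keeps both coordinates in the unit interval: [i] reaches 1 or [j] reaches
   0. *)
pose t := Num.min (1 - y i) (y j).
have t0 : 0 < t by rewrite lt_min subr_gt0 yi1 yj0.
have [ti tj] : t <= 1 - y i /\ t <= y j.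
  by split; rewrite ge_min lexx ?orbT.
pose z l := y l + t * transfer i j l.
have zi : z i = y i + t.
  by rewrite /z /transfer eqxx (negbTE neq_ij) /=; ring.
have zj : z j = y j - t.
  by rewrite /z /transfer eqxx eq_sym (negbTE neq_ij) /=; ring.
have zl l : l != i -> l != j -> z l = y l.
  by move=> /negbTE li /negbTE lj; rewrite /z /transfer li lj /=; ring.
exists z; split.
- move=> l; have [->|li] := eqVneq l i; first by rewrite zi; lra.
  have [->|lj] := eqVneq l j; first by rewrite zj; lra.
  by rewrite zl.
- rewrite big_split /= -mulr_sumr.
  under [X in t * X]eq_bigr => l _ do rewrite -[transfer i j l]mul1r.
  by rewrite (sum_transfer i j (fun=> 1)) subrr mulr0 addr0.
- rewrite costD -addrA gerDl.
  have := pair_energy_transfer i j.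
  have : 0 <= t ^+ 2 by rewrite sqr_ge0.
  by move: (t ^+ 2) => t2; nra.
- apply/properP; split.
    apply/subsetP => l; rewrite inE.
    have [->|li] := eqVneq l i; first by rewrite inE yi0 yi1.
    have [->|lj] := eqVneq l j; first by rewrite inE yj0 yj1.
    by rewrite inE zl.
  have [le_t|lt_t] := leP (1 - y i) (y j).
    exists i => //; rewrite inE zi /t min_l //.
    by rewrite addrC subrK ltxx andbF.
  exists j => //; rewrite inE zj /t min_r ?ltW //.
  by rewrite subrr ltxx.
Qed.

Lemma not_fractional (y : V -> R) (l : V) :
  0 <= y l <= 1 -> l \notin fractional y -> y l = (y l == 1)%:R.
Proof.
rewrite inE => /andP[y0 y1]; have [//|yn1] := eqVneq (y l) 1.
by rewrite !lt_neqAle y0 y1 yn1 !andbT negbK => /eqP <-.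
Qed.

(* Pipage rounding: the cost is concave along each direction
   [transfer i j], so mass can be moved between two fractional coordinates
   until one of them is integral. *)
Lemma cost_rounding (k : nat) (y : V -> R) :
  (forall l, 0 <= y l <= 1) -> \sum_l y l = k%:R ->
  exists B : {set V}, #|B| = k /\ cost (fun l => (l \in B)%:R) <= cost y.
Proof.
have [m] := ubnP #|fractional y|.
elim: m y => // m IH y; rewrite ltnS => ltm y01 sumy.
have [y_int|[i fi]] := set_0Vmem (fractional y).
  have yE l : y l = (l \in [set x | y x == 1])%:R.
    by rewrite inE; apply: not_fractional; rewrite // y_int inE.
  exists [set x | y x == 1]; split; last by rewrite (eq_cost yE).
  apply/eqP; rewrite -(eqr_nat R) -sumy; apply/eqP.
  by rewrite (eq_bigr _ (fun l _ => yE l)) -natr_sum -sum1_card big_mkcond.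
(* A lone fractional coordinate would put the integer [k] strictly between [c] and [c.+1]. *)
have [j fj neq_ij] : exists2 j, j \in fractional y & i != j.
  apply/exists_inP; apply: contraT.
  rewrite negb_exists_in => /forall_inP noj.
  have yE l : l != i -> y l = (y l == 1)%:R.
    move=> li; apply: not_fractional => //.
    by apply/negP => /noj; rewrite eq_sym li.
  move: sumy fi; rewrite (bigD1 i) //= (eq_bigr _ yE) -natr_sum inE.
  set c := (\sum_(_ | _) _)%N => sumy /andP[yi0 yi1].
  have : (c%:R : R) < k%:R by lra.
  have : (k%:R : R) < c.+1%:R by rewrite -natr1; lra.
  by rewrite !ltr_nat ltnS => kc; rewrite ltnNge kc.
have [z [z01 sumz costz fracz]] : exists z : V -> R, [/\ forall l, 0 <= z l <= 1,
    \sum_l z l = \sum_l y l, cost z <= cost y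
    & fractional z \proper fractional y].
  (* Reversing the transfer negates the slope, so one of the two directions does not raise the
     cost. *)
  have [le0|gt0] := leP (cost_slope y (transfer i j)) 0.
    exact: (cost_transfer y01 neq_ij).
  apply: (cost_transfer y01 (i := j) (j := i)) => //; first by rewrite eq_sym.
  have -> : cost_slope y (transfer j i) = - cost_slope y (transfer i j).
    rewrite -cost_slopeN; apply: eq_bigr => a _; apply: eq_bigr => b _.
    by rewrite !(transferC i j).
  by rewrite oppr_le0 ltW.
have [|B [cardB costB]] := IH z _ z01 (etrans sumz sumy).
  exact: leq_trans (proper_card fracz) ltm.
by exists B; split=> //; apply: le_trans costB costz.
Qed.

(** * From ordered adjacent pairs to edges *)

Lemma edges_inside_le (A : {set V}) :
  (2 * edges_inside adj A <= \sum_(i in A) \sum_(j in A) adj i j)%N.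
Proof.
pose P := [set p : V * V | [&& adj p.1 p.2, p.1 \in A & p.2 \in A]].
pose f (p : V * V) := [set p.1; p.2].
have -> : (\sum_(i in A) \sum_(j in A) adj i j)%N = #|P|.
  rewrite pair_big /= -sum1_card big_mkcond [RHS]big_mkcond /=.
  apply: eq_bigr => -[i j] _; rewrite inE /=.
  by case: (adj i j); case: (i \in A); case: (j \in A).
rewrite -sum1_card (partition_big f (mem [set E in edge_set adj | E \subset A])) /=.
  rewrite /edges_inside mulnC -sum_nat_const; apply: leq_sum => E.
  rewrite inE => /andP[/imset2P[x y _]].
  rewrite inE => /andP[_ axy] -> /subsetP subA.
  have [xA yA] : x \in A /\ y \in A by split; apply: subA; rewrite !inE eqxx ?orbT.
  (* The two orientations are distinct, so the fibre of [f] over an edge has at least two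
     elements. *)
  have neq : (x, y) != (y, x).
    by apply: contraTneq axy => -[-> _]; rewrite adj_irr.
  rewrite sum1_card -(_ : #|[set (x, y); (y, x)]| = 2%N); last by rewrite cards2 neq.
  apply: subset_leq_card; apply/subsetP => p; rewrite !inE.
  by case/orP => /eqP -> /=; rewrite unfold_in /= inE /= ?(adj_sym y) axy xA yA
    /f //= setUC.
move=> [i j]; rewrite !inE /= => /and3P[aij iA jA]; apply/andP; split.
  by apply/imset2P; exists i j; rewrite ?inE.
by apply/subsetP => l; rewrite !inE => /orP[] /eqP ->.
Qed.

Lemma edges_inside_cost (B : {set V}) :
  2 * (edges_inside adj (~: B) + edges_inside adj B)%:R
  <= cost (fun l => (l \in B)%:R).
Proof.
suff -> : cost (fun l => (l \in B)%:R)
  = (\sum_(i in ~: B) \sum_(j in ~: B) adj i j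
     + \sum_(i in B) \sum_(j in B) adj i j)%:R.
  by rewrite -natrM ler_nat mulnDr leq_add // edges_inside_le.
rewrite natrD !natr_sum [X in X + _]big_mkcond [X in _ + X]big_mkcond -big_split.
apply: eq_bigr => i _ /=; rewrite !natr_sum.
rewrite [\sum_(j in ~: B) _]big_mkcond [\sum_(j in B) _]big_mkcond /=.
rewrite inE; case: (i \in B); rewrite /= ?addr0 ?add0r; apply: eq_bigr => j _;
  rewrite ?inE /weight; case: (j \in B) => /=; ring.
Qed.

(** * Neighbourhoods in triangle-free graphs and Mantel's bound *)

Hypothesis triangle_free : ~ has_triangle adj.

Lemma pair_energy_nbr (v : V) : pair_energy (weight v) = 0.
Proof.
apply: big1 => i _; apply: big1 => j _; rewrite /weight.
case aij: (adj i j); rewrite ?mul0r //.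
case avi: (adj v i); rewrite ?mul0r ?mulr0 //.
case avj: (adj v j); rewrite ?mulr0 //.
by case: triangle_free; exists v, i, j.
Qed.

Lemma sum_weight_degree (v : V) :
  \sum_i \sum_j weight i j * (weight v i + weight v j) = 2 * nbr_degrees v.
Proof.
have -> : 2 * nbr_degrees v = nbr_degrees v + nbr_degrees v by ring.
under eq_bigr => i _ do
  (under eq_bigr => j _ do rewrite mulrDr); rewrite ?big_split /=.
under eq_bigr => i _ do rewrite big_split /=.
rewrite big_split /=; congr (_ + _).
  by apply: eq_bigr => i _; rewrite mulr_sumr; apply: eq_bigr => j _; ring.
rewrite exchange_big; apply: eq_bigr => j _; rewrite mulr_sumr.
by apply: eq_bigr => i _; rewrite (weightC i j); ring.
Qed.

Lemma cost_nbr (v : V) (b s : R) :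
  cost (fun i => b + s * weight v i)
  = volume * (1 - 2 * b + 2 * b ^+ 2) - 2 * s * nbr_degrees v * (1 - 2 * b).
Proof.
rewrite costD pair_energy_nbr mulr0 addr0.
have -> : cost (fun=> b) = volume * (1 - 2 * b + 2 * b ^+ 2).
  rewrite /volume mulr_suml; apply: eq_bigr => i _.
  by rewrite mulr_suml; apply: eq_bigr => j _; ring.
have -> : cost_slope (fun=> b) (weight v) = (2 * b - 1) * (2 * nbr_degrees v).
  rewrite -sum_weight_degree mulr_sumr; apply: eq_bigr => i _.
  by rewrite mulr_sumr; apply: eq_bigr => j _; ring.
by ring.
Qed.

(** No edge has both ends adjacent to [v], so each ordered edge contributes at most 1 in
    [sum_weight_degree]. *)
Lemma nbr_degrees_le (v : V) : 2 * nbr_degrees v <= volume.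
Proof.
rewrite -sum_weight_degree; apply: ler_sum => i _; apply: ler_sum => j _.
rewrite /weight; case aij: (adj i j); last by rewrite mul0r.
rewrite mul1r -natrD ler_nat.
case avi: (adj v i); case avj: (adj v j) => //.
by case: triangle_free; exists v, i, j.
Qed.

Lemma sum_nbr_degrees : \sum_v nbr_degrees v = \sum_v degree v ^+ 2.
Proof.
rewrite exchange_big; apply: eq_bigr => i _.
rewrite -mulr_suml expr2; congr (_ * _).
by apply: eq_bigr => v _; rewrite weightC.
Qed.

(** Mantel's theorem, [volume] being twice the number of edges. Summing [nbr_degrees_le] bounds the
    sum of squared degrees above; the variance of the degrees bounds it below. *)
Lemma volume_le : (0 < #|V|)%N -> 2 * volume <= #|V|%:R ^+ 2.
Proof.
rewrite -(ltr_nat R); set n := #|V|%:R => n0.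
pose q := volume / n.
have qn : q * n = volume by rewrite divfK ?gt_eqF.
have q0 : 0 <= q.
  apply: divr_ge0 (ltW n0); do 2![apply: sumr_ge0 => ? _]; exact: ler0n.
have sumS : \sum_v nbr_degrees v <= n * (volume / 2).
  apply: le_trans (_ : \sum_(v : V) (volume / 2) <= _).
    by apply: ler_sum => v _; have := nbr_degrees_le v; lra.
  by rewrite sumr_const -[_ *+ _]mulr_natl.
have : 0 <= \sum_v (degree v - q) ^+ 2 by apply: sumr_ge0 => v _; exact: sqr_ge0.
have -> : \sum_v (degree v - q) ^+ 2
   = \sum_v degree v ^+ 2 - 2 * q * volume + n * q ^+ 2.
  rewrite [n * _]mulr_natl -sumr_const mulr_sumr -sumrB -big_split /=.
  by apply: eq_bigr => v _; ring.
rewrite -sum_nbr_degrees -qn => ge0; rewrite -qn in sumS.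
have qnq : q * n * q <= q * n * (n / 2) by lra.
have [q_gt0|] := ltP 0 q; last by nra.
have q_le : q <= n / 2 by rewrite -(ler_pM2l (mulr_gt0 q_gt0 n0)).
by rewrite mulrA expr2 ler_pM2r //; lra.
Qed.

(** * Degree inequalities forced by costly vectors *)

Definition all_costly (k : nat) : Prop :=
  forall y : V -> R, (forall i, 0 <= y i <= 1) -> \sum_i y i = k%:R ->
  (#|V|%:R ^+ 2 - 2 * k%:R * #|V|%:R) / 2 < cost y.

Lemma sum_nbr_vector (v : V) (b s : R) :
  \sum_i (b + s * weight v i) = #|V|%:R * b + s * degree v.
Proof.
by rewrite big_split /= sumr_const -mulr_sumr -[b *+ _]mulr_natl.
Qed.

Lemma weight_range (v i : V) : 0 <= weight v i <= 1.
Proof. by rewrite /weight; case: (adj v i); rewrite /= ?ler01 lexx. Qed.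

(** The vector equal to [s = k / degree v] on N(v) and 0 elsewhere costs
    [volume - 2 * s * nbr_degrees v]. *)
Lemma costly_nbr_degrees_high (k : nat) (v : V) :
  (0 < k)%N -> all_costly k -> k%:R <= degree v ->
  2 * k%:R * nbr_degrees v
    < (volume - (#|V|%:R ^+ 2 - 2 * k%:R * #|V|%:R) / 2) * degree v.
Proof.
rewrite -(ltr_nat R) => k0 costly le_kd.
have d0 : 0 < degree v := lt_le_trans k0 le_kd.
pose s := k%:R / degree v.
have sd : s * degree v = k%:R by rewrite divfK ?gt_eqF.
have s01 : 0 <= s <= 1.
  by rewrite /s divr_ge0 ?(ltW k0) ?(ltW d0) //= ler_pdivrMr // mul1r.
have := costly (fun i => 0 + s * weight v i).
rewrite cost_nbr sum_nbr_vector => /(_ _ _)/wrap[].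
- by move=> i; have := weight_range v i; nra.
- by rewrite mulr0 add0r.
by rewrite -sd; nra.
Qed.

(* 29/100 can be replaced by any bound below 1 - 1/sqrt 2, the threshold at
   which [volume <= tau * (3 - 2 * b)] fails for [b = k/n]. *)
Lemma costly_nbr_degrees_low (k : nat) (v : V) :
  100 * k%:R <= 29 * #|V|%:R :> R -> all_costly k -> degree v < k%:R ->
  2 * nbr_degrees v < volume - (#|V|%:R ^+ 2 - 2 * k%:R * #|V|%:R) / 2.
Proof.
move=> kn costly lt_dk.
have d0 : 0 <= degree v by apply: sumr_ge0 => i _; case/andP: (weight_range v i).
have vol := volume_le (introT card_gt0P (ex_intro _ v isT)).
move: (costly); rewrite /all_costly.
set n : R := #|V|%:R in kn vol *; move: (k%:R) kn lt_dk => g kn lt_dk {}costly.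
have nd : 0 < n - degree v by lra.
(* The value off N(v) that brings the total weight to [g] when N(v) gets 1. *)
pose b := (g - degree v) / (n - degree v).
have bE : b * (n - degree v) = g - degree v by rewrite divfK ?gt_eqF.
have b0 : 0 < b by rewrite divr_gt0 // subr_gt0.
have bn : b * n <= g by nra.
have b29 : 100 * b <= 29 by nra.
have := costly (fun i => b + (1 - b) * weight v i).
rewrite cost_nbr sum_nbr_vector => /(_ _ _)/wrap[].
- by move=> i; have := weight_range v i; nra.
- by rewrite -/n; lra.
rewrite ltNge => lt_cost; rewrite ltNge; apply: contraNN lt_cost => le_S.
set tau := (n ^+ 2 - 2 * g * n) / 2 in le_S *.
have tauE : tau = (n ^+ 2 - 2 * g * n) / 2 by [].
clearbody tau; have tau_ge : 21 * n ^+ 2 <= 100 * tau by rewrite tauE; nra.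
have vol_tau : volume <= tau * (3 - 2 * b) by nra.
have P0 : 0 <= (1 - b) * (1 - 2 * b) by nra.
(* By [le_S] the cost is at most [b * volume + (1 - b) * (1 - 2 * b) * tau], and [vol_tau] bounds
   this by [tau]. *)
have := ler_wpM2r P0 le_S.
have := ler_wpM2l (ltW b0) vol_tau.
by lra.
Qed.

Lemma costly_nbr_degrees (k : nat) (v : V) :
  (0 < k)%N -> 100 * k%:R <= 29 * #|V|%:R :> R -> all_costly k ->
  nbr_degrees v + volume / #|V|%:R * (degree v - volume / #|V|%:R)
    < degree v ^+ 2.
Proof.
move=> k_gt0 kn costly.
have vol := volume_le (introT card_gt0P (ex_intro _ v isT)).
have := costly_nbr_degrees_low kn costly (v := v).
have := costly_nbr_degrees_high k_gt0 costly (v := v).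
move: k_gt0 kn; rewrite -(ltr_nat R) {costly}.
move: (k%:R : R) => g; move: vol; set n : R := #|V|%:R => vol g0 gn.
have n0 : 0 < n by lra.
set q := volume / n; have qn : q * n = volume by rewrite divfK ?gt_eqF.
rewrite -qn in vol *; clearbody q.
set d := degree v; set S := nbr_degrees v.
have q_le : 2 * q <= n by move: vol; rewrite mulrA expr2 ler_pM2r.
have [le_gd /(_ isT) high _|lt_dg _ /(_ isT) low] := leP g d.
  have d0 : 0 < d := lt_le_trans g0 le_gd.
  (* Left minus right is [(n - 2 * q) * (g - n / 2)]. This yields [S < q * d], and
     [(d - q) ^+ 2 >= 0] finishes. *)
  have T_le : q * n - (n ^+ 2 - 2 * g * n) / 2 <= 2 * g * q by nra.
  have := lt_le_trans high (ler_wpM2r (ltW d0) T_le).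
  rewrite -!mulrA ltr_pM2l // ltr_pM2l // => lt_S.
  by have := sqr_ge0 (d - q); nra.
(* The first square gives [d ^+ 2 - q * d + q ^+ 2 >= 3 / 4 * q ^+ 2]; the second compares this with
   the bound on [S], using [g <= n / 3]. *)
have := sqr_ge0 (2 * d - q); have := sqr_ge0 (3 * q - n); nra.
Qed.

(** * Summation over the vertices and conclusion *)

Lemma sum_degree_defect (q : R) :
  q * #|V|%:R = volume -> \sum_v q * (degree v - q) = 0.
Proof.
by move=> qn; rewrite -mulr_sumr sumrB sumr_const -[q *+ _]mulr_natr qn subrr mulr0.
Qed.

Lemma not_all_costly (k : nat) :
  (0 < #|V|)%N -> 100 * k%:R <= 29 * #|V|%:R :> R -> ~ all_costly k.
Proof.
(* For [k = 0] the zero vector costs [volume], and Mantel's bound suffices. *)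
move=> V_gt0 kn costly; have [k0|k_gt0] := posnP k.
  have := costly (fun=> 0); have := volume_le V_gt0.
  rewrite k0 big1 // => vol /(_ (fun=> _) erefl).
  have -> : cost (fun=> 0) = volume.
    by apply: eq_bigr => i _; apply: eq_bigr => j _; ring.
  by rewrite lexx ler01 => /(_ isT); lra.
have n0 : #|V|%:R != 0 :> R by rewrite pnatr_eq0 -lt0n.
have : \sum_v (nbr_degrees v
    + volume / #|V|%:R * (degree v - volume / #|V|%:R)) < \sum_v degree v ^+ 2.
  have [v _] := card_gt0P V_gt0.
  apply: ltr_sum => [|i _]; last exact: costly_nbr_degrees k_gt0 kn costly.
  by apply/hasP; exists v; rewrite ?mem_index_enum.
by rewrite big_split /= sum_degree_defect ?divfK // addr0 sum_nbr_degrees ltxx.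
Qed.

Lemma triangle_free_bipartition (k : nat) :
  (0 < #|V|)%N -> 100 * k%:R <= 29 * #|V|%:R :> R ->
  exists B : {set V}, #|B| = k /\
    4 * (edges_inside adj (~: B) + edges_inside adj B)%:R
      <= #|V|%:R ^+ 2 - 2 * k%:R * #|V|%:R :> R.
Proof.
move=> V_gt0 kn; have := not_all_costly V_gt0 kn.
rewrite /all_costly => costly; apply: contrapT => noB; apply: costly => y y01 sumy.
have [B [cardB costB]] := cost_rounding y01 sumy.
rewrite ltNge; apply/negP => cost_le; apply: noB; exists B; split=> //.
(* The cost counts uncut edges twice, so the threshold in [all_costly] is twice (n^2 - 2kn)/4. *)
have := edges_inside_cost B; lra.
Qed.

End Cost.

Theorem theorem1p5 (R : realType) (alpha beta : R)
    (halpha0 : 717%:R / 1000%:R <= alpha) (halpha1 : alpha <= 1)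
    (hbeta : (2%:R * alpha - 1) / 4%:R < beta) :
  exists n0 : nat,
    forall (V : finType) (adj : rel V),
      symmetric adj -> irreflexive adj ->
      (n0 <= #|V|)%N ->
      (forall A : {set V},
        #|A|%:Z = Num.floor (alpha * #|V|%:R) ->
        beta * #|V|%:R ^+ 2
          <= (edges_inside adj A + edges_inside adj (~: A))%:R) ->
      has_triangle adj.
Proof.
(* 143 * (717/1000 - 71/100) >= 1 absorbs the floor. *)
exists 143%N => V adj adj_sym adj_irr V_ge costly.
apply: contrapT => triangle_free.
have V_gt0 : (0 < #|V|)%N by apply: leq_trans V_ge.
have n_ge : 143 <= #|V|%:R :> R by rewrite ler_nat.
set n : R := #|V|%:R in n_ge costly.
have n0 : 0 < n by lra.
have an_ge : 717 / 1000 * n <= alpha * n by rewrite ler_pM2r.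
have an_le : alpha * n <= n by rewrite ler_piMl // ltW.
have [m floorE] : exists m : nat, Num.floor (alpha * n) = m%:Z.
  by exists `|Num.floor (alpha * n)|%N; rewrite gez0_abs // floor_ge0; lra.
have m_le : m%:R <= alpha * n by have := floor_le_tmp (alpha * n); rewrite floorE.
have m_gt : alpha * n < m%:R + 1.
  by have := floorD1_gt (alpha * n); rewrite floorE intrD.
have le_mV : (m <= #|V|)%N by rewrite -(ler_nat R) -/n; lra.
have kE : (#|V| - m)%:R = n - m%:R by rewrite natrB.
have [|B [cardB edgesB]] :=
  @triangle_free_bipartition R V adj adj_sym adj_irr triangle_free (#|V| - m) V_gt0.
  by rewrite kE; lra.
have := costly (~: B); rewrite setCK => /(_ _)/wrap[].
  by rewrite cardsCs setCK cardB subKn // floorE.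
(* With k = n - m, n^2 - 2kn = (2m - n)n is at most [(2 * alpha - 1) * n ^+ 2]: rounding down goes
   the right way. *)
have := ler_wpM2r (ltW n0) m_le.
have : (2 * alpha - 1) / 4 * n ^+ 2 < beta * n ^+ 2 by rewrite ltr_pM2r ?exprn_gt0.
by move: edgesB; rewrite kE -/n; lra.
Qed.
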